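(* Let $p$ be a prime with $p \equiv 3 \pmod 4$, let $l \ge 1$ be an integer and $q = p^l$. There is an absolute constant $c>0$ (independent of $p$, $l$ and $E$) such that for every $E \subset \mathbb{Z}_q^2$ with $|E| \geq \sqrt[3]{3}\, p^{2l-\frac{1}{3}}$ one has $|T_2(E)| \geq c\, q^3$.
   Context: $\mathbb{Z}_q$ denotes the ring of integers modulo $q$. $SO_2(\mathbb{Z}_q)=\{A\in M_2(\mathbb{Z}_q): AA^T=I,\ \det(A)=1\}$. A triangle in $E$ is an ordered triple $(x^1,x^2,x^3)\in E^3$. Two triangles $(x^1,x^2,x^3)$ and $(y^1,y^2,y^3)$ in $\mathbb{Z}_q^2$ are congruent if there exists $\theta\in SO_2(\mathbb{Z}_q)$ with $x^i-x^j=\theta(y^i-y^j)$ for all $i,j$. $T_2(E)$ denotes the set of congruence classes of triangles with vertices in $E$. The paper writes the conclusion as $|T_2(E)|\gtrsim q^3$. *)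

(* Defs.v *)
From mathcomp Require Import all_boot all_order all_algebra.
From mathcomp Require Import reals exp.

Set Implicit Arguments.
Unset Strict Implicit.
Unset Printing Implicit Defensive.

Import GRing.Theory.
Local Open Scope ring_scope.

(* As usual for 'Z_q, all definitions below are meaningful for q > 1 only. *)

Definition SO2 (q : nat) : {set 'M['Z_q]_2} :=
  [set A : 'M['Z_q]_2 | (A *m A^T == 1%:M) && (\det A == 1)].

Definition triangle (q : nat) := {ffun 'I_3 -> 'cV['Z_q]_2}.

Definition congruent (q : nat) (x y : triangle q) : bool :=
  [exists theta in SO2 q,
    [forall i, [forall j, x i - x j == theta *m (y i - y j)]]].

Definition triangles (q : nat) (E : {set 'cV['Z_q]_2}) : {set triangle q} :=
  [set x : triangle q | [forall i, x i \in E]].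

Definition T2 (q : nat) (E : {set 'cV['Z_q]_2}) : {set {set triangle q}} :=
  equivalence_partition (@congruent q) (triangles E).

Lemma congruentP (q : nat) (x y : triangle q) :
  reflect (exists2 theta : 'M['Z_q]_2, theta *m theta^T = 1%:M /\ \det theta = 1 &
             forall i j, x i - x j = theta *m (y i - y j))
          (congruent x y).
Proof.
apply: (iffP exists_inP) => [[A]|[A [AAT dA] Axy]].
  rewrite inE => /andP[/eqP AAT /eqP dA] /forallP Axy.
  by exists A => // i j; apply/eqP; apply: (forallP (Axy i)).
exists A; first by rewrite inE AAT dA !eqxx.
by apply/forallP => i; apply/forallP => j; apply/eqP.
Qed.

Lemma congruent_equiv (q : nat) : equivalence_rel (@congruent q).
Proof.
have refl x : @congruent q x x.
  apply/congruentP; exists 1%:M; last by move=> i j; rewrite mul1mx.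
  by rewrite trmx1 mulmx1 det1.
have sym x y : @congruent q x y -> congruent y x.
  case/congruentP => A [AAT dA] Axy; have ATA := mulmx1C AAT.
  apply/congruentP; exists A^T; first by rewrite trmxK det_tr.
  by move=> i j; rewrite Axy mulmxA ATA mul1mx.
have trans x y z : @congruent q x y -> congruent y z -> congruent x z.
  case/congruentP => A [AAT dA] Axy; case/congruentP => B [BBT dB] Byz.
  apply/congruentP; exists (A *m B); last first.
    by move=> i j; rewrite Axy Byz mulmxA.
  by rewrite trmx_mul mulmxA -(mulmxA A) BBT mulmx1 det_mulmx dA dB mulr1.
move=> x y z; split=> // xy; apply/idP/idP; last exact: trans.
exact/trans/sym.
Qed.

(* Main.v *)
Require Import Defs.
From mathcomp Require Import all_boot all_order all_algebra.
From mathcomp Require Import reals exp.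
From mathcomp Require Import ring lra.

Set Implicit Arguments.
Unset Strict Implicit.
Unset Printing Implicit Defensive.

Import Order.TTheory GRing.Theory Num.Theory.
Local Open Scope ring_scope.

(* Let nu(A, z) be the number of v in E with z + A v in E. By Cauchy-Schwarz,
   |E|^6 <= |T_2(E)| * sum_(A, z) nu(A, z)^3, since a pair of congruent
   triangles is a rigid motion (A, z) with three points of E landing in E.
   Write nu = m + g with m = |E|^2 / q^2 the mean over z; as nu <= |E|, it is
   enough to bound the second moment of g. Dually this amounts to bounding
     sum_(u, v) (sum_A g(A, u - A v))^2.
   After expansion of the square, a pair (A, A') with A - A' invertible
   contributes (sum_z g(A, z)) (sum_z g(A', z)) = 0, and any other pair is
   bounded by AM-GM. Since -1 is not a square mod p, det (A - A') is a non-unit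
   only if A = A' mod p, so each A has at most p^(l-1) such partners. *)

(** * Cauchy-Schwarz and indicator sums *)

Section FiniteSums.
Variable R : realFieldType.

(** Cauchy-Schwarz against the constant 1, from AM-GM on each product [f x * f y]. *)
Lemma sqr_sum_le_card (T : finType) (A : {set T}) (f : T -> R) :
  (\sum_(x in A) f x) ^+ 2 <= #|A|%:R * \sum_(x in A) f x ^+ 2.
Proof.
have -> : #|A|%:R * \sum_(x in A) f x ^+ 2 =
    \sum_(x in A) \sum_(y in A) (f x ^+ 2 + f y ^+ 2) / 2.
  have -> : \sum_(x in A) \sum_(y in A) (f x ^+ 2 + f y ^+ 2) / 2 =
      \sum_(x in A) \sum_(y in A) (f x ^+ 2 / 2) +
      \sum_(x in A) \sum_(y in A) (f y ^+ 2 / 2).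
    rewrite -big_split; apply: eq_bigr => x _; rewrite -big_split.
    by apply: eq_bigr => y _; rewrite /= mulrDl.
  rewrite [X in _ + X]exchange_big /= -big_split mulr_sumr; apply: eq_bigr => x _.
  by rewrite /= sumr_const -[(_ / 2) *+ _]mulr_natl; field.
rewrite expr2 big_distrl; apply: ler_sum => x _ /=; rewrite big_distrr /=.
apply: ler_sum => y _; have := sqr_ge0 (f x - f y); nra.
Qed.

Lemma sum_indicator (T : finType) (A : {set T}) :
  \sum_x (x \in A)%:R = #|A|%:R :> R.
Proof. by rewrite -natr_sum -sum1_card [in RHS]big_mkcond. Qed.

End FiniteSums.

(** * Moments of incidence counts for an abstract family of maps *)

Section Incidence.
(** In the application [S] is the rotation group acting on the plane [V], [bad] marks pairs of
    rotations with non-invertible difference, and [B] is p^(l-1). *)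
Variables (R : realFieldType) (V : finZmodType) (T : finType).
Variables (S : {set T}) (act : T -> V -> V) (bad : rel T) (B : nat).
Variable E : {set V}.
Hypothesis bad_sym : symmetric bad.
Hypothesis bad_inj : forall t t', t \in S -> t' \in S -> ~~ bad t t' ->
  injective (fun v => act t v - act t' v).
Hypothesis bad_card : forall t, t \in S -> (#|[set t' in S | bad t t']| <= B)%N.
Hypothesis B_gt0 : (0 < B)%N.

Definition incidences t z : R := \sum_v (v \in E)%:R * (z + act t v \in E)%:R.

Definition incidence_mean : R := #|E|%:R ^+ 2 / #|V|%:R.

Definition incidence_dev t z := incidences t z - incidence_mean.

Local Notation nu := incidences.
Local Notation m := incidence_mean.
Local Notation g := incidence_dev.
Local Notation N t := (\sum_z g t z ^+ 2).

Lemma card_V_gt0 : 0 < #|V|%:R :> R.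
Proof. by rewrite ltr0n; apply/card_gt0P; exists 0. Qed.

Lemma sum_shift (f : V -> R) w : \sum_z f (z + w) = \sum_z f z.
Proof.
rewrite [RHS](reindex (+%R^~ w)) //; exists (fun z => z - w) => z _.
  by rewrite addrK.
by rewrite subrK.
Qed.

Lemma sum_incidences t : \sum_z nu t z = #|E|%:R ^+ 2.
Proof.
rewrite exchange_big /=.
under eq_bigr do rewrite -mulr_sumr (sum_shift (fun x => (x \in E)%:R)) sum_indicator.
by rewrite -mulr_suml sum_indicator expr2.
Qed.

Lemma sum_incidence_dev t : \sum_z g t z = 0.
Proof.
rewrite sumrB sum_incidences sumr_const -[m *+ _]mulr_natr /m divfK ?subrr //.
exact: lt0r_neq0 card_V_gt0.
Qed.

Lemma incidences_ge0 t z : 0 <= nu t z.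
Proof. by apply: sumr_ge0 => v _; rewrite mulr_ge0 ?ler0n. Qed.

Lemma incidences_le t z : nu t z <= #|E|%:R.
Proof.
rewrite -sum_indicator; apply: ler_sum => v _.
by rewrite ler_piMr ?ler0n // lern1 leq_b1.
Qed.

Lemma sum_shear (f : V -> R) t : \sum_v \sum_u f (u - act t v) = #|V|%:R * \sum_z f z.
Proof.
under eq_bigr do rewrite (sum_shift f).
by rewrite sumr_const mulr_natl.
Qed.

(** AM-GM on each term; for fixed v the map u -> u - [act t v] is a translation, so each v
    contributes a full copy of the second moments. *)
Lemma cross_sum_le t t' :
  \sum_v \sum_u g t (u - act t v) * g t' (u - act t' v) <=
  #|V|%:R * (N t + N t') / 2.
Proof.
have -> : #|V|%:R * (N t + N t') / 2 =
   \sum_v \sum_u (g t (u - act t v) ^+ 2 / 2 + g t' (u - act t' v) ^+ 2 / 2).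
  under [RHS]eq_bigr do rewrite big_split /= -!mulr_suml.
  rewrite [RHS]big_split /= -!mulr_suml (sum_shear (fun z => g t z ^+ 2)).
  by rewrite (sum_shear (fun z => g t' z ^+ 2)) mulrDr mulrDl.
do 2![apply: ler_sum => ? _]; set x := g t _; set y := g t' _.
by have := sqr_ge0 (x - y); nra.
Qed.

(** The arguments of the two factors are independent coordinates on V x V: their difference
    determines [act t v - act t' v], hence v, then u. The sum thus factors into two sums of
    mean-zero functions. *)
Lemma cross_sum_eq0 t t' : t \in S -> t' \in S -> ~~ bad t t' ->
  \sum_v \sum_u g t (u - act t v) * g t' (u - act t' v) = 0.
Proof.
move=> tS t'S nb; rewrite pair_bigA /=.
pose h (x : V * V) := (x.2 - act t x.1, x.2 - act t' x.1).
have h_inj : injective h.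
  move=> [v u] [v1 u1] [/= e1 e2].
  have ev : v = v1.
    apply: (bad_inj tS t'S nb) => /=.
    have : u - act t' v - (u - act t v) = u1 - act t' v1 - (u1 - act t v1).
      by rewrite e1 e2.
    have E3 (a b c : V) : a - b - (a - c) = c - b.
      by rewrite opprB addrC addrA subrK.
    by rewrite !E3.
  by move: e1; rewrite ev => /addIr ->.
transitivity (\sum_x g t x.1 * g t' x.2).
  by rewrite [RHS](reindex_inj h_inj).
rewrite -(pair_bigA _ (fun a b => g t a * g t' b)) /=.
by under eq_bigr do rewrite -mulr_sumr sum_incidence_dev mulr0; rewrite big1.
Qed.

Lemma sum_dual_sqr_le :
  \sum_v \sum_u (\sum_(t in S) g t (u - act t v)) ^+ 2 <=
  B%:R * #|V|%:R * \sum_(t in S) N t.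
Proof.
have N_ge0 t : 0 <= N t by apply: sumr_ge0 => z _; exact: sqr_ge0.
pose C t t' := \sum_v \sum_u g t (u - act t v) * g t' (u - act t' v).
pose D t t' : R := if bad t t' then #|V|%:R * (N t + N t') / 2 else 0.
have -> : \sum_v \sum_u (\sum_(t in S) g t (u - act t v)) ^+ 2 =
    \sum_(t in S) \sum_(t' in S) C t t'.
  under eq_bigr do under eq_bigr do
    (rewrite expr2 mulr_suml; under eq_bigr do rewrite mulr_sumr).
  under eq_bigr do rewrite exchange_big /=.
  rewrite exchange_big /=; apply: eq_bigr => t _.
  under eq_bigr do rewrite exchange_big /=.
  by rewrite exchange_big.
apply: (@le_trans _ _ (\sum_(t in S) \sum_(t' in S) D t t')).
  apply: ler_sum => t tS; apply: ler_sum => t' t'S; rewrite /D.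
  by case: ifPn => [_|nb]; [exact: cross_sum_le | rewrite /C cross_sum_eq0].
(* By symmetry of [bad], the halves carrying [N t] and [N t'] have the same total. *)
have -> : \sum_(t in S) \sum_(t' in S) D t t' =
    \sum_(t in S) \sum_(t' in S) (if bad t t' then #|V|%:R * N t else 0).
  pose F t t' : R := if bad t t' then #|V|%:R * N t / 2 else 0.
  have -> : \sum_(t in S) \sum_(t' in S) D t t' =
     \sum_(t in S) \sum_(t' in S) F t t' + \sum_(t in S) \sum_(t' in S) F t' t.
    rewrite -big_split; apply: eq_bigr => t _; rewrite -big_split.
    apply: eq_bigr => t' _; rewrite /D /F [bad t' t]bad_sym /=.
    by case: ifP => _; rewrite ?addr0 // mulrDr mulrDl.
  rewrite [X in _ + X]exchange_big -big_split; apply: eq_bigr => t _.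
  rewrite -big_split; apply: eq_bigr => t' _; rewrite /F /=.
  by case: ifP => _; rewrite ?addr0 // -splitr.
rewrite mulr_sumr; apply: ler_sum => t tS.
rewrite -big_mkcondr /= -mulrA sumr_const -[leLHS]mulr_natl.
apply: ler_wpM2r; first by rewrite mulr_ge0 ?ler0n.
rewrite ler_nat; apply: leq_trans (bad_card tS).
by rewrite cardsE; apply: subset_leq_card; apply/subsetP => x.
Qed.

Lemma sum_incidence_dev_sqr_le :
  \sum_(t in S) N t <= B%:R * #|V|%:R * #|E|%:R ^+ 2.
Proof.
set lam := B%:R * #|V|%:R.
have lam0 : 0 < lam by rewrite mulr_gt0 ?card_V_gt0 ?ltr0n.
pose W v u := \sum_(t in S) g t (u - act t v).
pose e v : R := (v \in E)%:R.
(* As [g t] sums to 0, one factor of its square may be replaced by [nu t]; unfolding [nu] with u = z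
   + [act t v] gives the pairing of [W] with the indicator of E x E. *)
have SE : \sum_(t in S) N t = \sum_v \sum_u e v * e u * W v u.
  have -> : \sum_(t in S) N t = \sum_(t in S) \sum_z g t z * nu t z.
    apply: eq_bigr => t _.
    have -> : \sum_z g t z * nu t z = \sum_z (g t z ^+ 2 + g t z * m).
      by apply: eq_bigr => z _; rewrite expr2 -mulrDr subrK.
    by rewrite big_split /= -mulr_suml sum_incidence_dev mul0r addr0.
  transitivity (\sum_(t in S) \sum_v \sum_u e v * e u * g t (u - act t v)).
    apply: eq_bigr => t _.
    under eq_bigr do rewrite mulr_sumr.
    rewrite exchange_big; apply: eq_bigr => v _.
    rewrite -(sum_shift (fun u => e v * e u * g t (u - act t v)) (act t v)).
    by apply: eq_bigr => z _; rewrite addrK mulrC.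
  rewrite exchange_big; apply: eq_bigr => v _.
  rewrite exchange_big; apply: eq_bigr => u _.
  by rewrite mulr_sumr.
(* AM-GM weighted by [lam], so that after [sum_dual_sqr_le] the quadratic term is exactly half of
   the sum being bounded and can be absorbed. *)
have le1 : \sum_v \sum_u e v * e u * W v u <=
    \sum_v \sum_u (lam / 2 * (e v * e u) + (2 * lam)^-1 * W v u ^+ 2).
  do 2![apply: ler_sum => ? _]; rewrite /e -natrM mulnb.
  set w := W _ _; set b := (_ && _).
  rewrite -subr_ge0.
  have -> : lam / 2 * b%:R + (2 * lam)^-1 * w ^+ 2 - b%:R * w =
     (2 * lam)^-1 * (lam * b%:R - w) ^+ 2.
    by case: b => /=; field; exact: lt0r_neq0.
  by rewrite mulr_ge0 ?sqr_ge0 // invr_ge0 mulr_ge0 // ltW.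
have le2 : \sum_v \sum_u (lam / 2 * (e v * e u) + (2 * lam)^-1 * W v u ^+ 2) <=
    lam / 2 * #|E|%:R ^+ 2 + (2 * lam)^-1 * (lam * \sum_(t in S) N t).
  under eq_bigr do rewrite big_split /= -!mulr_sumr sum_indicator.
  rewrite big_split /= -!mulr_sumr -mulr_suml sum_indicator -expr2.
  rewrite lerD2l ler_wpM2l ?sum_dual_sqr_le //.
  by rewrite invr_ge0 mulr_ge0 // ltW.
move: (le_trans le1 le2); rewrite -SE.
have -> : (2 * lam)^-1 * (lam * \sum_(t in S) N t) = (\sum_(t in S) N t) / 2.
  by field; exact: lt0r_neq0.
by lra.
Qed.

Lemma sum_incidences_cube_le :
  \sum_(t in S) \sum_z nu t z ^+ 3 <=
  2 * #|S|%:R * #|E|%:R ^+ 6 / #|V|%:R ^+ 2 + 2 * B%:R * #|V|%:R * #|E|%:R ^+ 3.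
Proof.
(* Pointwise with x = nu: 2 m^2 x + 2 x (x - m)^2 - x^3 = x (x - 2m)^2 >= 0, and x <= |E| bounds the
   factor x of the middle term. *)
apply: (@le_trans _ _ (\sum_(t in S) \sum_z
    (2 * m ^+ 2 * nu t z + 2 * #|E|%:R * g t z ^+ 2))).
  apply: ler_sum => t _; apply: ler_sum => z _; rewrite /g.
  move: (incidences_ge0 t z) (incidences_le t z); set x := nu t z => n0 nE.
  have h1 : 0 <= x * (x - 2 * m) ^+ 2 by rewrite mulr_ge0 ?sqr_ge0.
  have h2 : 0 <= (#|E|%:R - x) * (x - m) ^+ 2 by rewrite mulr_ge0 ?sqr_ge0 ?subr_ge0.
  by nra.
under eq_bigr do rewrite big_split /= -!mulr_sumr sum_incidences.
rewrite big_split /= sumr_const -mulr_sumr; apply: lerD.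
  rewrite -mulr_natl /m le_eqVlt; apply/orP; left; apply/eqP.
  by field; exact: lt0r_neq0 card_V_gt0.
rewrite -mulrA; apply: le_trans (ler_wpM2l _ (ler_wpM2l _ sum_incidence_dev_sqr_le)) _ => //.
by rewrite le_eqVlt; apply/orP; left; apply/eqP; ring.
Qed.

End Incidence.

(** * Sums of two squares modulo p, and 2 x 2 determinants *)

Lemma odd_3mod4 (p : nat) : (p %% 4 = 3)%N -> odd p.
Proof. by move=> p3; rewrite (divn_eq p 4) p3 oddD oddM andbF. Qed.

Lemma Fp_two_neq0 (p : nat) : prime p -> odd p -> (2 : 'F_p) != 0.
Proof.
move=> p_pr p_odd.
by rewrite -unitfE unitFpE // coprime_sym prime_coprime // dvdn2 negbK.
Qed.

(** If y is nonzero, z = x / y has z^2 = -1, so z^p = z^(4k+3) = -z; Fermat gives z^p = z, forcing z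
    = 0, which is absurd. *)
Lemma Fp_add_sqr_eq0 (p : nat) (x y : 'F_p) : prime p -> (p %% 4 = 3)%N ->
  x ^+ 2 + y ^+ 2 = 0 -> x = 0 /\ y = 0.
Proof.
move=> p_pr p3 xy0.
have two_neq0 := Fp_two_neq0 p_pr (odd_3mod4 p3).
have fermat (z : 'F_p) : z ^+ p = z.
  by rewrite -(natr_Zp z) -natrX -(Fp_nat_mod p_pr) fermat_little // Fp_nat_mod.
have [y0|y_neq0] := eqVneq y 0.
  by split=> //; apply/eqP; move: xy0; rewrite y0 expr0n addr0 => /eqP; rewrite sqrf_eq0.
pose z := x / y.
have z2 : z ^+ 2 = -1.
  rewrite /z expr_div_n; apply: (@mulIf _ (y ^+ 2)); rewrite ?sqrf_eq0 //.
  by rewrite divfK ?sqrf_eq0 // mulN1r; apply/eqP; rewrite -addr_eq0 xy0.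
have zN : z = - z.
  have pE : p = (p %/ 4 * 4 + 3)%N by rewrite {1}(divn_eq p 4) p3.
  rewrite -{1}(fermat z) [X in z ^+ X]pE exprD (_ : 3 = 2 + 1)%N // exprD expr1 z2 mulN1r.
  rewrite mulnC (_ : 4 = 2 * 2)%N // -mulnA exprM z2 exprM sqrrN expr1n expr1n.
  by rewrite mul1r.
have : z = 0.
  apply/eqP; move/eqP: zN; rewrite -addr_eq0 -mulr2n -mulr_natl mulf_eq0.
  by rewrite (negbTE two_neq0).
move=> z0; move/eqP: z2; rewrite z0 expr0n /= eq_sym oppr_eq0.
by rewrite (negbTE (oner_neq0 _)).
Qed.

Lemma det2E (K : comPzRingType) (A : 'M[K]_2) :
  \det A = A 0 0 * A 1 1 - A 0 1 * A 1 0.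
Proof.
rewrite (expand_det_row _ 0) !big_ord_recl big_ord0 addr0 /cofactor !det_mx11 !mxE /=.
have -> : lift ord0 ord0 = 1 :> 'I_2 by apply: val_inj.
have -> : lift 1 0 = 0 :> 'I_2 by apply: val_inj.
by rewrite /= expr0 mul1r expr1 mulN1r mulrN.
Qed.

Lemma ord2P (k : 'I_2) : k = 0 \/ k = 1.
Proof. by case: k => [[|[|//]] k2]; [left|right]; apply: val_inj. Qed.

(** * Reduction modulo p, and the size and structure of the rotation group over Z_q *)

Section PrimePowerResidue.
Variables p l : nat.
Hypotheses (p_pr : prime p) (l_gt0 : (0 < l)%N).
Local Notation Zq := 'Z_(p ^ l).

Lemma prime_power_gt1 : (1 < p ^ l)%N.
Proof. by rewrite -{1}(exp1n l) ltn_exp2r // prime_gt1. Qed.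

Definition residue (x : Zq) : 'F_p := (x : nat)%:R.

Lemma residue_mod n : ((n %% (p ^ l))%N%:R : 'F_p) = n%:R.
Proof. by rewrite -(Fp_nat_mod p_pr) modn_dvdm ?dvdn_exp // Fp_nat_mod. Qed.

Lemma residueD : {morph residue : x y / x + y}.
Proof.
move=> x y; rewrite /residue -natrD -[RHS]residue_mod.
by rewrite -[X in (_ %% X)%N](Zp_cast prime_power_gt1).
Qed.

Lemma residueM : {morph residue : x y / x * y}.
Proof.
move=> x y; rewrite /residue -natrM -[RHS]residue_mod.
by rewrite -[X in (_ %% X)%N](Zp_cast prime_power_gt1).
Qed.

Lemma residueB : {morph residue : x y / x - y}.
Proof.
by move=> x y; apply/eqP; rewrite eq_sym subr_eq -residueD subrK.
Qed.

Lemma unit_residue x : (x \is a GRing.unit) = (residue x != 0).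
Proof.
rewrite -unitfE -{1}(natr_Zp x) unitZpE ?prime_power_gt1 //.
by rewrite coprime_pexpl // unitFpE.
Qed.

(** On a residue class the quotient x -> x / p is injective, with values below p^(l-1). *)
Lemma card_residue c : (#|[set x : Zq | residue x == c]| <= p ^ l.-1)%N.
Proof.
have lt_div (x : Zq) : (x %/ p < p ^ l.-1)%N.
  rewrite ltn_divLR ?prime_gt0 // -expnSr prednK //.
  by rewrite -[X in (_ < X)%N](Zp_cast prime_power_gt1).
rewrite -[X in (_ <= X)%N]card_ord -(card_in_imset (f := fun x => Ordinal (lt_div x))).
  exact: max_card.
move=> x y; rewrite !inE => /eqP xc /eqP yc [exy]; apply: val_inj => /=.
rewrite (divn_eq x p) (divn_eq y p) exy; congr (_ + _)%N.
by rewrite -!val_Fp_nat //; congr val; rewrite -[LHS]/(residue x) xc -yc.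
Qed.

(** In (x - y)(x + y) = 0 the factor x + y reduces to twice a nonzero residue, so it is a unit. *)
Lemma eq_sqr_residue (x y : Zq) : odd p -> residue x = residue y ->
  residue x != 0 -> x ^+ 2 = y ^+ 2 -> x = y.
Proof.
move=> p_odd xy x0 sq; apply/eqP; rewrite -subr_eq0.
have u : x + y \is a GRing.unit.
  by rewrite unit_residue residueD -xy -mulr2n -mulr_natl mulf_neq0 ?Fp_two_neq0.
by rewrite -(mulrK u (x - y)) -subr_sqr sq subrr mul0r.
Qed.

Lemma eq_sqr_unit (x y : Zq) : odd p -> residue x != 0 ->
  x ^+ 2 = y ^+ 2 -> x = y \/ x = - y.
Proof.
move=> p_odd x0 sq.
have : residue x ^+ 2 == residue y ^+ 2 by rewrite !expr2 -!residueM -!expr2 sq.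
rewrite eqf_sqr => /orP[]/eqP e; [left|right]; apply: eq_sqr_residue => //.
  by rewrite -[- y]add0r residueB (_ : residue 0 = 0) // sub0r.
by rewrite sqrrN.
Qed.

Lemma SO2P (A : 'M[Zq]_2) : A \in SO2 (p ^ l) ->
  [/\ A 1 1 = A 0 0, A 0 1 = - A 1 0 & A 0 0 ^+ 2 + A 1 0 ^+ 2 = 1].
Proof.
rewrite inE => /andP[/eqP AA /eqP].
rewrite det2E => dA.
have e00 := congr1 (fun M => fun_of_matrix M 0 0) AA.
have e01 := congr1 (fun M => fun_of_matrix M 0 1) AA.
move: e00 e01; rewrite !mxE !big_ord_recl !big_ord0 !mxE /=.
have -> : lift ord0 ord0 = 1 :> 'I_2 by apply: val_inj.
rewrite !addr0 -[ord0]/(0 : 'I_2).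
set a := A 0 0 in dA *; set b := A 0 1 in dA *; set c := A 1 0 in dA *; set d := A 1 1 in dA *.
move=> e1 e2.
(* Zero divisors forbid cancelling, so d is multiplied by 1 = a^2 + b^2 and regrouped into the
   determinant and the product of the two rows; likewise for c. *)
have da : d = a.
  have -> : d = d * (a * a + b * b) by rewrite e1 mulr1.
  have -> : d * (a * a + b * b) = a * (a * d - b * c) + b * (a * c + b * d) by ring.
  by rewrite dA e2; ring.
have cb : c = - b.
  have -> : c = c * (a * a + b * b) by rewrite e1 mulr1.
  have -> : c * (a * a + b * b) = a * (a * c + b * d) - b * (a * d - b * c) by ring.
  by rewrite dA e2; ring.
by split; rewrite ?cb ?opprK // sqrrN !expr2.
Qed.

Lemma SO2_inj (A B : 'M[Zq]_2) : A \in SO2 (p ^ l) -> B \in SO2 (p ^ l) ->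
  A 0 0 = B 0 0 -> A 1 0 = B 1 0 -> A = B.
Proof.
move=> /SO2P[a1 a2 _] /SO2P[b1 b2 _] e0 e1; apply/matrixP => i j.
by case: (ord2P i) => ->; case: (ord2P j) => ->; rewrite ?a1 ?a2 ?b1 ?b2 ?e0 ?e1.
Qed.

Lemma SO2_residue_neq0 (A : 'M[Zq]_2) : A \in SO2 (p ^ l) ->
  residue (A 0 0) != 0 \/ residue (A 1 0) != 0.
Proof.
move=> /SO2P[_ _ nA]; have [a0|] := eqVneq (residue (A 0 0)) 0; last by left.
right; apply/eqP => b0; have := congr1 residue nA.
rewrite !expr2 residueD !residueM a0 b0 mul0r addr0 => /esym/eqP.
by apply/negP; rewrite -unit_residue unitr1.
Qed.

(** Some entry of the first column is a unit. Its square is fixed by the other entry, so it is known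
    up to sign: 2q matrices for each of the two positions of the unit. *)
Lemma card_SO2 : odd p -> (#|SO2 (p ^ l)| <= 4 * p ^ l)%N.
Proof.
move=> p_odd.
have half (i j : 'I_2) : i != j ->
    (#|[set A in SO2 (p ^ l) | residue (A i 0%R) != 0%R]| <= 2 * p ^ l)%N.
  (* This bit encodes the sign: it separates an entry from its opposite, unless they coincide, by
     comparing representatives. *)
  move=> ij; pose f (A : 'M[Zq]_2) := ((A i 0%R : nat) < (- A i 0)%R)%N.
  have ij01 (A B : 'M[Zq]_2) : A j 0 = B j 0 -> A i 0 = B i 0 -> A \in SO2 (p ^ l) ->
      B \in SO2 (p ^ l) -> A = B.
    move=> ej ei sA sB; move: ij ej ei; clear f.
    case: (ord2P i) => ->; case: (ord2P j) => -> // _ ej ei; exact: SO2_inj.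
  have sumij A : A \in SO2 (p ^ l) -> A i 0 ^+ 2 = 1 - A j 0 ^+ 2.
    case/SO2P => _ _ <-; move: ij; clear f ij01.
    by case: (ord2P i) => ->; case: (ord2P j) => -> // _; rewrite ?addrK // addrC addKr.
  have -> : (2 * p ^ l = #|{: bool * Zq}|)%N.
    by rewrite card_prod card_bool card_ord Zp_cast // prime_power_gt1.
  rewrite -(card_in_imset (f := fun A : 'M[Zq]_2 => (f A, A j 0))); first exact: max_card.
  move=> A B; rewrite !inE => /andP[sA A0] /andP[sB B0] [fAB eAB].
  have sA' : A \in SO2 (p ^ l) by rewrite inE.
  have sB' : B \in SO2 (p ^ l) by rewrite inE.
  apply: ij01 => //.
  have sq : A i 0 ^+ 2 = B i 0 ^+ 2 by rewrite !sumij // eAB.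
  have [//|AN] := eq_sqr_unit p_odd A0 sq.
  by move: fAB; rewrite /f AN opprK; case: ltngtP => // /val_inj.
have sub : SO2 (p ^ l) \subset [set A in SO2 (p ^ l) | residue (A 0%R 0%R) != 0%R] :|:
    [set A in SO2 (p ^ l) | residue (A 1%R 0%R) != 0%R].
  apply/subsetP => A sA; rewrite in_setU !in_set.
  move: (sA); rewrite inE => ->.
  by case: (SO2_residue_neq0 sA) => ->; rewrite ?orbT.
apply: leq_trans (subset_leq_card sub) _; apply: leq_trans (leq_card_setU _ _) _.
rewrite (_ : 4 = 2 + 2)%N // mulnDl; apply: leq_add; first exact: (half 0 1).
exact: (half 1 0).
Qed.

Definition SO2_close (A B : 'M[Zq]_2) := \det (A - B) \isn't a GRing.unit.

Lemma SO2_close_sym : symmetric SO2_close.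
Proof. by move=> A B; rewrite /SO2_close -opprB -scaleN1r detZ sqrrN expr1n mul1r. Qed.

Lemma SO2_far_inj A B : ~~ SO2_close A B ->
  injective (fun v : 'cV[Zq]_2 => A *m v - B *m v).
Proof.
rewrite /SO2_close negbK -unitmxE => u v w; rewrite -!mulmxBl => e.
by rewrite -(mulKmx u v) e mulKmx.
Qed.

Hypothesis p3 : (p %% 4 = 3)%N.

(** For rotations, det (A - B) is the sum of the squares of the differences in the first column;
    modulo p such a sum vanishes only trivially. *)
Lemma SO2_close_residue A B : A \in SO2 (p ^ l) -> B \in SO2 (p ^ l) ->
  SO2_close A B ->
  residue (B 0 0) = residue (A 0 0) /\ residue (B 1 0) = residue (A 1 0).
Proof.
move=> /SO2P[a1 a2 _] /SO2P[b1 b2 _]; rewrite /SO2_close det2E !mxE a1 a2 b1 b2.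
rewrite unit_residue negbK => /eqP h.
have /(Fp_add_sqr_eq0 p_pr p3)[] :
    residue (A 0 0 - B 0 0) ^+ 2 + residue (A 1 0 - B 1 0) ^+ 2 = 0.
  by rewrite !expr2 -!residueM -residueD -[RHS]h; congr residue; ring.
by rewrite !residueB => /eqP + /eqP; rewrite !subr_eq0 => /eqP -> /eqP ->.
Qed.

(** Partners share the first-column residues of A, one of which is nonzero. The entry there is
    determined by its residue and its square, so only the other entry is free, inside one residue
    class. *)
Lemma card_SO2_close A : A \in SO2 (p ^ l) ->
  (#|[set B in SO2 (p ^ l) | SO2_close A B]| <= p ^ l.-1)%N.
Proof.
move=> sA.
have sS B : B \in [set B in SO2 (p ^ l) | SO2_close A B] ->
    [/\ B \in SO2 (p ^ l), residue (B 0 0) = residue (A 0 0) &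
        residue (B 1 0) = residue (A 1 0)].
  rewrite in_set => /andP[sB cl]; rewrite sB.
  by have [] := SO2_close_residue sA sB cl.
have norm B : B \in SO2 (p ^ l) -> B 0 0 ^+ 2 + B 1 0 ^+ 2 = 1 by case/SO2P.
have [u|u] := SO2_residue_neq0 sA.
- apply: leq_trans (card_residue (residue (A 1 0))).
  rewrite -(card_in_imset (f := fun B : 'M[Zq]_2 => B 1 0)).
    apply: subset_leq_card; apply/subsetP => _ /imsetP[B /sS[_ _ e] ->].
    by rewrite inE e.
  move=> B C /sS[sB B0 B1] /sS[sC C0 C1] /= e; apply: SO2_inj => //.
  apply: eq_sqr_residue; rewrite ?(odd_3mod4 p3) ?B0 //.
  by apply: (addIr (B 1 0 ^+ 2)); rewrite norm // e norm.
- apply: leq_trans (card_residue (residue (A 0 0))).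
  rewrite -(card_in_imset (f := fun B : 'M[Zq]_2 => B 0 0)).
    apply: subset_leq_card; apply/subsetP => _ /imsetP[B /sS[_ e _] ->].
    by rewrite inE e.
  move=> B C /sS[sB B0 B1] /sS[sC C0 C1] /= e; apply: SO2_inj => //.
  apply: eq_sqr_residue; rewrite ?(odd_3mod4 p3) ?B1 //.
  by apply: (addrI (B 0 0 ^+ 2)); rewrite norm // e norm.
Qed.

End PrimePowerResidue.

(** * Double counting of congruent pairs of triangles *)

Section CongruentPairs.
Variables (q : nat) (E : {set 'cV['Z_q]_2}).
Local Notation V := 'cV['Z_q]_2.
Local Notation pairs :=
  [set xy : triangle q * triangle q |
    [&& xy.1 \in triangles E, xy.2 \in triangles E & congruent xy.1 xy.2]].

Definition overlap (A : 'M['Z_q]_2) (z : V) : {set V} :=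
  [set v in E | z + A *m v \in E].

Lemma overlap_incidences (R : realFieldType) A z :
  #|overlap A z|%:R = incidences R (fun A v => A *m v) E A z.
Proof.
rewrite -sum_indicator; apply: eq_bigr => v _.
by rewrite inE -natrM mulnb.
Qed.

Lemma card_triangles : #|triangles E| = (#|E| ^ 3)%N.
Proof.
rewrite -[X in (_ ^ X)%N](card_ord 3) -card_ffun_on; apply: eq_card => x.
by rewrite inE.
Qed.

(** A pair is recovered from a rigid motion (A, z) and [y], whose three vertices are free in the
    overlap. Several motions may give the same pair, hence an inequality. *)
Lemma card_congruent_pairs_le :
  (#|pairs| <= \sum_(A in SO2 q) \sum_z #|overlap A z| ^ 3)%N.
Proof.
pose Q := [set w : 'M['Z_q]_2 * (V * triangle q) |
  (w.1 \in SO2 q) && (w.2.2 \in ffun_on (overlap w.1 w.2.1))].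
pose h (w : 'M['Z_q]_2 * (V * triangle q)) : triangle q * triangle q :=
  ([ffun i => w.2.1 + w.1 *m w.2.2 i], w.2.2).
have sub : pairs \subset h @: Q.
  apply/subsetP => -[x y]; rewrite !inE /=.
  case/and3P => /forallP xE /forallP yE /exists_inP[A sA /forallP xy].
  (* The translation is read off at vertex 0; congruence of the edges to that vertex fixes the
     others. *)
  pose z := x 0 - A *m y 0.
  have xE' i : x i = z + A *m y i.
    move: (forallP (xy i) 0) => /eqP; rewrite mulmxBr => e.
    by rewrite /z -addrA [- _ + _]addrC -e addrC subrK.
  apply/imsetP; exists (A, (z, y)).
    rewrite inE /= sA; apply/ffun_onP => i.
    by rewrite inE yE -xE' xE.
  by congr pair; apply/ffunP => i; rewrite ffunE.
apply: leq_trans (subset_leq_card sub) _; apply: leq_trans (leq_imset_card _ _) _.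
rewrite -sum1_card.
have -> : (\sum_(w in Q) 1 = \sum_(w : 'M['Z_q]_2 * (V * triangle q) |
    (w.1 \in SO2 q) && (w.2.2 \in ffun_on (overlap w.1 w.2.1))) 1)%N.
  by apply: eq_bigl => w; rewrite inE.
rewrite -(pair_big_dep _ (fun A (w : V * triangle q) => w.2 \in ffun_on (overlap A w.1))
  (fun _ _ => 1%N)) /=.
apply: leq_sum => A _.
rewrite -(pair_big_dep xpredT (fun z (y : triangle q) => y \in ffun_on (overlap A z))
  (fun _ _ => 1%N)) /=.
by apply: leq_sum => z _; rewrite sum1_card card_ffun_on card_ord.
Qed.

Lemma sum_sqr_classes_le : (\sum_(B in T2 E) #|B| ^ 2 <= #|pairs|)%N.
Proof.
have eqv : {in triangles E & &, equivalence_rel (@congruent q)}.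
  by move=> x y z _ _ _; exact: congruent_equiv.
have part : partition (T2 E) (triangles E) by exact: equivalence_partitionP.
have -> : #|pairs| = (\sum_(x in triangles E) #|[set y in triangles E | congruent x y]|)%N.
  rewrite -sum1_card.
  under [RHS]eq_bigr do rewrite -sum1_card.
  rewrite pair_big_dep /=; apply: eq_bigl => -[x y].
  by rewrite !inE.
rewrite (set_partition_big _ part) /=; apply: leq_sum => B BT.
rewrite expnS expn1 -sum_nat_const; apply: leq_sum => x xB.
apply: subset_leq_card; apply/subsetP => y yB.
have sBD : B \subset triangles E.
  by rewrite -(cover_partition part); exact: bigcup_sup.
have xD := subsetP sBD x xB; have yD := subsetP sBD y yB.
rewrite inE yD /= -(pblock_equivalence_partition eqv xD yD).
by rewrite (def_pblock (partition_trivIset part) BT xB).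
Qed.

Lemma card_pow6_le_T2 : (#|E| ^ 6 <=
  #|T2 E| * \sum_(A in SO2 q) \sum_z #|overlap A z| ^ 3)%N.
Proof.
apply: (@leq_trans (#|T2 E| * \sum_(B in T2 E) #|B| ^ 2)); last first.
  by rewrite leq_mul2l (leq_trans sum_sqr_classes_le card_congruent_pairs_le) orbT.
have part : partition (T2 E) (triangles E).
  by apply: equivalence_partitionP => x y z _ _ _; exact: congruent_equiv.
(* The |E|^3 triangles split into classes, so |E|^6 is the square of the sum of the class sizes. *)
rewrite (_ : 6 = 3 * 2)%N // expnM -card_triangles (card_partition part).
rewrite -(ler_nat rat) natrX natrM !natr_sum.
under [X in _ * X]eq_bigr do rewrite natrX.
exact: sqr_sum_le_card.
Qed.

End CongruentPairs.

(** * The size threshold and the final computation *)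

Lemma cube_threshold (R : realType) (p l : nat) (x : R) : prime p -> (0 < l)%N ->
  3 `^ (1 / 3) * p%:R `^ (2 * l%:R - 1 / 3) <= x -> 3 * p%:R ^+ (6 * l).-1 <= x ^+ 3.
Proof.
move=> p_pr l_gt0 h.
have p0 : 0 < p%:R :> R by rewrite ltr0n prime_gt0.
have a0 : 0 <= 3 `^ (1 / 3) * p%:R `^ (2 * l%:R - 1 / 3) :> R.
  by rewrite mulr_ge0 ?powR_ge0.
apply: le_trans (_ : (3 `^ (1 / 3) * p%:R `^ (2 * l%:R - 1 / 3)) ^+ 3 <= _); last first.
  by rewrite lerXn2r // nnegrE // (le_trans a0).
rewrite exprMn -!powR_mulrn ?powR_ge0 ?ler0n // -!powRrM.
(* Since l > 0 the predecessor is the true 6l - 1, three times 2l - 1/3. *)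
rewrite -[(6 * l).-1]subn1 natrB ?muln_gt0 // natrM.
have -> : 1 / 3 * 3%:R = 1 :> R by field.
have -> : (2 * l%:R - 1 / 3) * 3%:R = 6%:R * l%:R - 1%:R :> R by field.
by rewrite powRr1.
Qed.

Theorem theorem1p1 (R : realType) :
  exists c : R, 0 < c /\
    forall (p l : nat) (E : {set 'cV['Z_(p ^ l)%N]_2}),
      prime p -> (p %% 4 = 3)%N -> (1 <= l)%N ->
      3 `^ (1 / 3) * p%:R `^ (2 * l%:R - 1 / 3) <= #|E|%:R :> R ->
      c * (p ^ l)%N%:R ^+ 3 <= #|T2 E|%:R.
Proof.
(* 10 = 8 + 2: |SO_2| <= 4q bounds the mean term by 8 |E|^6 / q^3, and p^(l-1) q^5 <= |E|^3 bounds
   the deviation term by 2 |E|^6 / q^3. *)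
exists (1 / 10); split; first by lra.
move=> p l E p_pr p3 l_gt0 /(cube_threshold p_pr l_gt0) hE.
have pR_gt0 : 0 < p%:R :> R by rewrite ltr0n prime_gt0.
have cardV : #|{: 'cV['Z_(p ^ l)]_2}| = ((p ^ l) ^ 2)%N.
  by rewrite card_mx card_ord Zp_cast // prime_power_gt1.
have B_gt0 : (0 < p ^ l.-1)%N by rewrite expn_gt0 prime_gt0.
have /= := @sum_incidences_cube_le R _ _ (SO2 (p ^ l)) (fun A v => A *m v)
  (@SO2_close p l) (p ^ l.-1) E (@SO2_close_sym p l)
  (fun A B _ _ => @SO2_far_inj p l A B) (card_SO2_close p_pr l_gt0 p3) B_gt0.
under eq_bigr do under eq_bigr do rewrite -overlap_incidences -natrX.
under eq_bigr do rewrite -natr_sum.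
rewrite -natr_sum cardV.
have := card_pow6_le_T2 E; rewrite -(ler_nat R) natrM natrX.
have := card_SO2 p_pr l_gt0 (odd_3mod4 p3); rewrite -(ler_nat R) natrM.
set s := #|SO2 _|%:R; set N := (\sum_(A in _) _)%:R; set T := #|T2 E|%:R.
set e := #|E|%:R in hE *; rewrite !natrX.
set Q := p%:R ^+ l; set b := p%:R ^+ l.-1.
have Q_gt0 : 0 < Q by rewrite exprn_gt0.
have b_gt0 : 0 < b by rewrite exprn_gt0.
have T_ge0 : 0 <= T by rewrite ler0n.
(* The exponent splits as 6l - 1 = (l - 1) + 5l, matching the threshold to the partner bound
   p^(l-1). *)
have bQE : p%:R ^+ (6 * l).-1 = b * Q ^+ 5 :> R.
  rewrite -exprM -exprD; congr (_ ^+ _).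
  case: l l_gt0 {E hE cardV B_gt0 s N T e Q b Q_gt0 b_gt0 T_ge0} => // k _.
  by rewrite mulnS [(k.+1 * 5)%N]mulSn [RHS]addnCA -[(k + k * 5)%N]mulnS [(k * 6)%N]mulnC.
rewrite bQE in hE.
have bQ_gt0 : 0 < b * Q ^+ 5 by rewrite mulr_gt0 ?exprn_gt0.
move=> s_le e6_le N_le.
have e3_gt0 : 0 < e ^+ 3 by lra.
have e6E : e ^+ 6 = (e ^+ 3) ^+ 2 by rewrite -exprM.
rewrite e6E in e6_le N_le.
set f := e ^+ 3 in hE e3_gt0 e6_le N_le; clearbody f.
have {}N_le : N * Q ^+ 3 <= 10 * f ^+ 2.
  have -> : 10 * f ^+ 2 =
      (2 * (4 * Q) * f ^+ 2 / (Q ^+ 2) ^+ 2 + 2 * (f / Q ^+ 5) * Q ^+ 2 * f) * Q ^+ 3.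
    by field; rewrite ?lt0r_neq0.
  rewrite ler_pM2r ?exprn_gt0 //; apply: le_trans N_le _; apply: lerD.
    rewrite ler_pM2r ?invr_gt0 ?exprn_gt0 // ler_pM2r ?exprn_gt0 //.
    by rewrite ler_pM2l // ltr0n.
  rewrite ler_pM2r // ler_pM2r ?exprn_gt0 // ler_pM2l ?ltr0n //.
  by rewrite ler_pdivlMr ?exprn_gt0 //; lra.
have : f ^+ 2 * Q ^+ 3 <= f ^+ 2 * (10 * T).
  apply: (le_trans (ler_wpM2r (exprn_ge0 3 (ltW Q_gt0)) e6_le)).
  by rewrite -mulrA (le_trans (ler_wpM2l T_ge0 N_le)) // mulrCA mulrA mulrC mulrA.
by rewrite ler_pM2l ?exprn_gt0 //; lra.
Qed.
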